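(* Let $G$ be a graphon, let $b,\sigma:[0,T]\times\mathbb{R}\times\mathcal{M}^2(\mathbb{R})\to\mathbb{R}$ be such that for each $t$ and each $\mu\in\mathcal{P}^2(I\times\mathbb{R})$ the function $(v,y)\mapsto b(t,y,[G\mu](v))$ is $\mu$-integrable. Let $\mu$ be a law on $\widehat\Omega$ in $\mathcal{P}_{\mathcal S}$ with time marginals $\mu_t$, let $\pi^*(t,u,x,v,y):=\mathbf{1}_{\{B^\mu(t,v,y)\ge0\}}$, and suppose the drift and diffusion functions $B^\mu,\Sigma^\mu$ of $\mu$ satisfy the identification relations $$B^\mu(t,u,x)=\frac{b(t,x,[G\mu_t](u))+\int\pi^*(t,u,x,v,y)B^\mu(t,v,y)\,\mu_t(\mathrm{d}v,\mathrm{d}y)}{1+\int\pi^*(t,v,y,u,x)\,\mu_t(\mathrm{d}v,\mathrm{d}y)},\qquad \Sigma^\mu(t,u,x)=\frac{\sigma(t,x,[G\mu_t](u))}{1+\int\pi^*(t,v,y,u,x)\,\mu_t(\mathrm{d}v,\mathrm{d}y)}$$ (with finite integrals). Then the limiting dynamics $$\mathrm{d}X_t=\frac{b(t,X_t,[G\mu_t](U))+\int\pi^*(t,U,X_t,v,y)B^\mu(t,v,y)\mu_t(\mathrm{d}v,\mathrm{d}y)}{1+\int\pi^*(t,v,y,U,X_t)\mu_t(\mathrm{d}v,\mathrm{d}y)}\mathrm{d}t+\frac{\sigma(t,X_t,[G\mu_t](U))}{1+\int\pi^*(t,v,y,U,X_t)\mu_t(\mathrm{d}v,\mathrm{d}y)}\mathrm{d}W_t,\quad\mu_t=\mathcal{L}(U,X_t),$$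 take the simpler form $$\mathrm{d}X_t=B(t,U,X_t,\mu_t)\mathrm{d}t+\Sigma(t,U,X_t,\mu_t)\mathrm{d}W_t,\qquad\mu_t=\mathcal{L}(U,X_t),$$ where $B,\Sigma:[0,T]\times I\times\mathbb{R}\times\mathcal{P}^2(I\times\mathbb{R})\to\mathbb{R}$ are given by $$B(t,u,x,\mu)=\tfrac12\big(b(t,x,[G\mu](u))+c(t,\mu)\big)^+-\big(b(t,x,[G\mu](u))+c(t,\mu)\big)^-,$$ $$\Sigma(t,u,x,\mu)=\big(1-\tfrac12\mathbf{1}_{\{B(t,u,x,\mu)\ge0\}}\big)\sigma(t,x,[G\mu](u)),$$ that is, $B^\mu(t,u,x)=B(t,u,x,\mu_t)$ and $\Sigma^\mu(t,u,x)=\Sigma(t,u,x,\mu_t)$, and where $c:[0,T]\times\mathcal{P}^2(I\times\mathbb{R})\to\mathbb{R}_+$ is the unique solution of the integral equation $$c(t,\mu)=\frac12\int\big(c(t,\mu)+b(t,y,[G\mu](v))\big)^+\mu(\mathrm{d}v,\mathrm{d}y).$$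
   Context: $I=[0,1]$, $T>0$, $\widehat\Omega=I\times C([0,T],\mathbb{R})$ with canonical element $(\widehat U,\widehat X)$. A graphon is a symmetric measurable function $I\times I\to[0,1]$. $\mathcal{M}^2(\mathbb{R})$: finite positive measures on $\mathbb{R}$ with finite second moment; $\mathcal{P}^2(I\times\mathbb{R})$: probability measures with finite second moment. For a probability measure $\mu$ on $I\times\mathbb{R}$, $[G\mu](u)(\mathrm{d}x):=\int_{v\in I}G(u,v)\mu(\mathrm{d}v,\mathrm{d}x)$. For a law $\mu$ on $\widehat\Omega$, $\mu_t:=\mu\circ(\widehat U,\widehat X_t)^{-1}$. $a^+=\max(a,0)$, $a^-=\max(-a,0)$. $\mathcal{P}_{\mathcal S}$ is the set of laws $\mu$ on $\widehat\Omega$ with $\mu\circ\widehat U^{-1}=\mathrm{Unif}([0,1])$, with a prescribed initial law $\mu\circ(\widehat U,\widehat X_0)^{-1}=\nu$ (where $\nu$ has uniform first marginal and finite $p$-th moment for some $p>2$), under which $\widehat X$ is an Itô process $\widehat X_t=\widehat X_0+\int_0^tB^\mu_s\mathrm{d}s+\int_0^t\Sigma^\mu_s\mathrm{d}W^\mu_s$ for a $\mu$-Brownian motion $W^\mu$, with $\widehat{\mathbb{E}}^\mu\int_0^T(|B^\mu_s|^2+|\Sigma^\mu_s|^2)\mathrm{d}s<\infty$; here $B^\mu_s=B^\mu(s,\widehat U,\widehat X_s)$ and $\Sigma^\mu_s=\Sigma^\mu(s,\widehat U,\widehat X_s)$. $W$ is a Brownian motion on a filtered probability space, and $U$ is the label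 random variable. *)

(* Defs.v *)
From HB Require Import structures.
From mathcomp Require Import all_boot all_order all_algebra.
From mathcomp Require Import all_classical all_reals all_analysis.
From mathcomp Require Import measurable_realfun.

Set Implicit Arguments.
Unset Strict Implicit.
Unset Printing Implicit Defensive.
Import Order.TTheory GRing.Theory Num.Theory.
Import numFieldNormedType.Exports.

Local Open Scope classical_set_scope.
Local Open Scope ring_scope.

Section labels.
Context (R : realType).

(* I = [0,1] as a type, with the trace of the Borel sigma-algebra of R *)
Definition unit_subtype : Type := set_type `[0 : R, 1]%classic.

HB.instance Definition _ := Choice.on unit_subtype.

Let zero_in_unit : (0 : R) \in `[0 : R, 1]%classic.
Proof. by rewrite inE /= in_itv /= lexx ler01. Qed.

HB.instance Definition _ :=
  isPointed.Build unit_subtype (exist _ (0 : R) zero_in_unit).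

Definition unit_val (u : unit_subtype) : R := \val u.

Definition label : Type := g_sigma_algebra_preimageType unit_val.
HB.instance Definition _ := Measurable.on label.

Definition label_val (u : label) : R := unit_val u.

End labels.
Arguments label_val {R} u.

Section graphons.
Context (R : realType).
Local Notation I := (label R).

Record graphon := Graphon {
  graphon_fun :> I -> I -> R ;
  graphon_measurable : measurable_fun setT (fun p : I * I => graphon_fun p.1 p.2) ;
  graphon_sym : forall u v, graphon_fun u v = graphon_fun v u ;
  graphon_itv : forall u v, 0 <= graphon_fun u v <= 1 }.

(* [G m](u)(A) = int_{(v,x)} G(u,v) 1_A(x) m(dv,dx) *)
Definition graphon_op (G : graphon) (m : probability (I * R)%type R) (u : I)
    (A : set R) : \bar R :=
  (\int[m]_(z in snd @^-1` A) (G u z.1)%:E)%E.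

Section graphon_op_measure.
Variables (G : graphon) (m : probability (I * R)%type R) (u : I).

Let graphon_ge0 v : (0 <= (G u v)%:E)%E.
Proof. by rewrite lee_fin; have /andP[] := graphon_itv G u v. Qed.

Let mG D : measurable_fun D (EFin \o (fun z : I * R => G u z.1)).
Proof.
apply: measurable_funTS; apply/measurable_EFinP.
apply: (measurableT_comp (graphon_measurable G)
  (g := fun z : I * R => (u, z.1))).
by apply/measurable_fun_pair => //; exact: measurable_cst.
Qed.

Let m_snd (A : set R) : measurable A -> measurable (@snd I R @^-1` A).
Proof. by move=> mA; rewrite -[X in measurable X]setTI; exact: measurable_snd. Qed.

Let op0 : graphon_op G m u set0 = 0%E.
Proof. by rewrite /graphon_op preimage_set0 integral_set0. Qed.

Let op_ge0 A : (0 <= graphon_op G m u A)%E.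
Proof. exact: integral_ge0. Qed.

Let op_sigma_additive : semi_sigma_additive (graphon_op G m u).
Proof.
move=> F mF tF mUF; rewrite /graphon_op; apply: cvg_toP.
  apply: ereal_nondecreasing_is_cvgn => i j ij.
  by apply: lee_sum_nneg_natr => // k _ _; exact: op_ge0.
rewrite preimage_bigcup ge0_integral_bigcup//=.
- by move=> k; exact: m_snd.
- apply/trivIsetP => i j _ _ ij; rewrite -preimage_setI.
  by rewrite (trivIsetP.1 tF i j)// preimage_set0.
Qed.

HB.instance Definition _ := isMeasure.Build _ _ _ (graphon_op G m u)
  op0 op_ge0 op_sigma_additive.

Let op_fin : fin_num_fun (graphon_op G m u).
Proof.
apply: lty_fin_num_fun; apply: (@le_lt_trans _ _ (\int[m]_(z in setT) 1)%E).
  rewrite [leLHS]/(graphon_op G m u setT) /graphon_op preimage_setT.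
  apply: ge0_le_integral => //=.
  by move=> z _; rewrite lee_fin; have /andP[] := graphon_itv G u z.1.
rewrite integral_cst// mul1e.
exact: le_lt_trans (probability_le1 m measurableT) (ltry 1).
Qed.

HB.instance Definition _ := Measure_isFinite.Build _ _ _ (graphon_op G m u)
  op_fin.

End graphon_op_measure.
End graphons.

Section moments.
Context (R : realType).
Local Notation I := (label R).

(* finiteness of the p-th moment of m for the Euclidean norm |(u,x)| *)
Definition finite_moment (p : R) (m : probability (I * R)%type R) : Prop :=
  (\int[m]_z (Num.sqrt (label_val z.1 ^+ 2 + z.2 ^+ 2) `^ p)%:E < +oo)%E.

Definition P2 (m : probability (I * R)%type R) : Prop := finite_moment 2 m.

Definition uniform_label d (Om : measurableType d) (P : probability Om R)
    (U : Om -> I) : Prop :=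
  forall A : set R, measurable A ->
    P ((label_val \o U) @^-1` A) = uniform_prob (@ltr01 R) A.

End moments.

Section canonical_space.
Context (R : realType) (T : R).
Local Notation I := (label R).

Definition path_space : Type := continuousType (set_type `[0, T]%classic) R.

HB.instance Definition _ := Choice.on path_space.
HB.instance Definition _ :=
  isPointed.Build path_space (cst (0 : R) : continuousType _ _).

Definition path_eval (s : set_type `[0, T]%classic) (w : path_space) : R := w s.

(* cylinder sets; they generate the Borel sigma-algebra of the sup norm *)
Definition cylinders : set (set path_space) :=
  [set C | exists s (A : set R), measurable A /\ C = path_eval s @^-1` A].

Definition path : Type := g_sigma_algebraType cylinders.
HB.instance Definition _ := Measurable.on path.

Definition path_val (t : R) (w : path) : R :=
  valL_ 0 (w : set_type `[0, T]%classic -> R) t.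

Definition canonical_space : Type := (I * path)%type.
HB.instance Definition _ := Measurable.on canonical_space.

(* the canonical element (U^, X^), with X^ set to 0 outside [0,T] *)
Definition canonical_U (om : canonical_space) : I := om.1.
Definition canonical_X (t : R) (om : canonical_space) : R := path_val t om.2.

Definition canonical_UX (t : R) (om : canonical_space) : I * R :=
  (canonical_U om, canonical_X t om).

Lemma measurable_path_val t : measurable_fun setT (path_val t).
Proof.
have [tT|tNT] := boolP (t \in `[0, T]%classic); last first.
  rewrite (_ : path_val t = cst 0); first exact: measurable_cst.
  by apply/funext => w; rewrite /path_val /= oinv_set_val insubN.
rewrite (_ : path_val t = path_eval (exist _ t tT)).
  move=> _ A mA; rewrite setTI; apply: sub_sigma_algebra.
  by exists (exist _ t tT), A.
by apply/funext => w; rewrite /path_val /= oinv_set_val insubT.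
Qed.

Lemma measurable_canonical_UX t : measurable_fun setT (canonical_UX t).
Proof.
apply/measurable_fun_pair; first exact: measurable_fst.
exact: measurableT_comp (measurable_path_val t) measurable_snd.
Qed.

HB.instance Definition _ t :=
  isMeasurableFun.Build _ _ _ _ (canonical_UX t) (measurable_canonical_UX t).

(* mu_t, the law of (U^, X^_t) under mu *)
Definition time_marginal (mu : probability canonical_space R) (t : R) :
    probability (I * R)%type R :=
  distribution mu (canonical_UX t).

End canonical_space.

Section stochastic_calculus.
Context (R : realType) d (Om : measurableType d) (P : probability Om R) (T : R).
Local Notation leb := (@lebesgue_measure R).

Definition is_filtration (F : R -> set (set Om)) : Prop :=
  (forall t, 0 <= t <= T -> sigma_algebra setT (F t) /\ F t `<=` measurable) /\
  (forall s t : R, 0 <= s -> s <= t -> t <= T -> F s `<=` F t).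

Definition measurable_wrt (S : set (set Om)) d' (E : measurableType d')
    (f : Om -> E) : Prop :=
  forall A, measurable A -> S (f @^-1` A).

Definition adapted (F : R -> set (set Om)) (X : R -> Om -> R) : Prop :=
  forall t, 0 <= t <= T -> measurable_wrt (F t) (X t).

Definition continuous_path (X : R -> Om -> R) (w : Om) : Prop :=
  {within `[0, T], continuous (X ^~ w)}.

Definition increment (W : R -> Om -> R) (s t : R) (w : Om) : R :=
  W t w - W s w.

Record brownian (F : R -> set (set Om)) (W : R -> Om -> R) : Prop := Brownian {
  brownian_adapted : adapted F W ;
  brownian_path : {ae P, forall w, W 0 w = 0 /\ continuous_path W w} ;
  brownian_gaussian : forall s t : R, 0 <= s -> s < t -> t <= T ->
    forall A : set R, measurable A ->
      P (increment W s t @^-1` A) = normal_prob 0 (Num.sqrt (t - s)) A ;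
  brownian_indep : forall s t : R, 0 <= s -> s < t -> t <= T ->
    forall (C : set Om) (A : set R), F s C -> measurable A ->
      P (C `&` increment W s t @^-1` A) = (P C * P (increment W s t @^-1` A))%E }.

(* H_s = sum_(i < n) xi_i 1_(t_i < s <= t_(i+1)), with xi_i bounded and
   F_(t_i)-measurable *)
Record simple_process (F : R -> set (set Om)) := SimpleProcess {
  sp_size : nat ;
  sp_time : nat -> R ;
  sp_coef : nat -> Om -> R ;
  sp_time_itv : forall i, (i <= sp_size)%N -> 0 <= sp_time i <= T ;
  sp_time_le : forall i, (i < sp_size)%N -> sp_time i <= sp_time i.+1 ;
  sp_coef_meas : forall i, (i < sp_size)%N ->
    measurable_wrt (F (sp_time i)) (sp_coef i) ;
  sp_coef_bounded : exists K, forall i w, (i < sp_size)%N ->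
    `|sp_coef i w| <= K }.

Definition sp_val F (S : simple_process F) (s : R) (w : Om) : R :=
  \sum_(i < sp_size S)
    sp_coef S i w * (sp_time S i < s <= sp_time S i.+1)%R%:R.

Definition sp_integral F (S : simple_process F) (W : R -> Om -> R)
    (t : R) (w : Om) : R :=
  \sum_(i < sp_size S) sp_coef S i w *
    (W (Num.min (sp_time S i.+1) t) w - W (Num.min (sp_time S i) t) w).

(* M_t = int_0^t H_s dW_s on [0,T], as the L^2-limit of integrals of simple
   processes, in a version with almost surely continuous paths *)
Definition ito_integral (F : R -> set (set Om)) (W H M : R -> Om -> R) : Prop :=
  (forall t, 0 <= t <= T -> measurable_fun setT (M t)) /\
  {ae P, forall w, continuous_path M w} /\
  exists S : nat -> simple_process F,
    (fun n => \int[P]_w \int[leb]_(s in `[0%R, T])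
       ((sp_val (S n) s w - H s w) ^+ 2)%:E)%E @ \oo --> 0%E /\
    (forall t, 0 <= t <= T ->
      (fun n => \int[P]_w ((sp_integral (S n) W t w - M t w) ^+ 2)%:E)%E
        @ \oo --> 0%E).

(* X is an Ito process for the F-Brownian motion W with the Markovian
   coefficients beta(s,U,X_s) and gamma(s,U,X_s):
   dX_t = beta(t,U,X_t) dt + gamma(t,U,X_t) dW_t on [0,T] *)
Record ito_dynamics (F : R -> set (set Om)) (W : R -> Om -> R)
    (U : Om -> label R) (X : R -> Om -> R)
    (beta gamma : R -> label R -> R -> R) : Prop := ItoDynamics {
  ito_filtration : is_filtration F ;
  ito_brownian : brownian F W ;
  ito_label : measurable_wrt (F 0) U ;
  ito_adapted : adapted F X ;
  ito_continuous : forall w, continuous_path X w ;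
  ito_drift_meas : measurable_fun (`[0, T]%classic `*` setT)
    (fun z : R * (label R * R) => beta z.1 z.2.1 z.2.2) ;
  ito_diffusion_meas : measurable_fun (`[0, T]%classic `*` setT)
    (fun z : R * (label R * R) => gamma z.1 z.2.1 z.2.2) ;
  ito_energy : (\int[P]_w \int[leb]_(s in `[0%R, T])
    (`|beta s (U w) (X s w)| ^+ 2 + `|gamma s (U w) (X s w)| ^+ 2)%:E < +oo)%E ;
  ito_equation : exists M : R -> Om -> R,
    ito_integral F W (fun s w => gamma s (U w) (X s w)) M /\
    {ae P, forall w, forall t, 0 <= t <= T ->
      X t w = X 0 w + (\int[leb]_(s in `[0, t]) beta s (U w) (X s w)) + M t w} }.

End stochastic_calculus.

Section admissible_laws.
Context (R : realType) (T : R).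
Local Notation I := (label R).

(* mu belongs to P_S with initial law nu, and Bmu, Smu are drift and diffusion
   functions of mu; the filtration and W live on the canonical space itself *)
Definition PS (nu : probability (I * R)%type R)
    (mu : probability (canonical_space T) R) (Bmu Smu : R -> I -> R -> R) : Prop :=
  uniform_label mu (@canonical_U R T) /\
  (forall A, measurable A -> time_marginal mu 0 A = nu A) /\
  exists (F : R -> set (set (canonical_space T)))
         (W : R -> canonical_space T -> R),
    ito_dynamics mu T F W (@canonical_U R T) (@canonical_X R T) Bmu Smu.

End admissible_laws.

Section coefficients.
Context (R : realType).
Local Notation I := (label R).
(* b(t,x,.) and sigma(t,x,.) are only ever evaluated at finite measures with
   finite second moment (the [G m](u) with m in P2); their values elsewhere are
   irrelevant *)
Local Notation coef := (R -> R -> {finite_measure set R -> \bar R} -> R).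

Variables (G : graphon R) (b sigma : coef).

Definition pi_star (Bmu : R -> I -> R -> R) (t : R) (u : I) (x : R) (v : I)
    (y : R) : R :=
  (0 <= Bmu t v y)%R%:R.

Definition limit_drift (pistar : R -> I -> R -> I -> R -> R)
    (Bmu : R -> I -> R -> R) (mu_ : R -> probability (I * R)%type R)
    (t : R) (u : I) (x : R) : R :=
  (b t x (graphon_op G (mu_ t) u)
     + \int[mu_ t]_z (pistar t u x z.1 z.2 * Bmu t z.1 z.2))
  / (1 + \int[mu_ t]_z pistar t z.1 z.2 u x).

Definition limit_diffusion (pistar : R -> I -> R -> I -> R -> R)
    (mu_ : R -> probability (I * R)%type R) (t : R) (u : I) (x : R) : R :=
  sigma t x (graphon_op G (mu_ t) u) / (1 + \int[mu_ t]_z pistar t z.1 z.2 u x).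

Definition pos_part (a : R) : R := Num.max a 0.
Definition neg_part (a : R) : R := Num.max (- a) 0.

(* c maps [0,T] x P2 to R_+ and solves the integral equation *)
Definition c_solution (T : R) (c : R -> probability (I * R)%type R -> R) : Prop :=
  forall t m, 0 <= t <= T -> P2 m ->
    0 <= c t m /\
    (c t m)%:E = ((2^-1)%:E *
      \int[m]_z (pos_part (c t m + b t z.2 (graphon_op G m z.1)))%:E)%E.

Definition B_fun (c : R -> probability (I * R)%type R -> R)
    (t : R) (u : I) (x : R) (m : probability (I * R)%type R) : R :=
  2^-1 * pos_part (b t x (graphon_op G m u) + c t m)
  - neg_part (b t x (graphon_op G m u) + c t m).

Definition Sigma_fun (c : R -> probability (I * R)%type R -> R)
    (t : R) (u : I) (x : R) (m : probability (I * R)%type R) : R :=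
  (1 - 2^-1 * (0 <= B_fun c t u x m)%R%:R) * sigma t x (graphon_op G m u).

End coefficients.

(* Main.v *)
(* The weight pi^*(t,u,x,v,y) does not depend on (u,x), so with
   C(t) = int (B^mu)^+ d(mu_t) the identification relation reads
   B^mu (1 + 1_{B^mu >= 0}) = b + C. Hence B^mu and b + C have the same sign and
   B^mu = (b + C)^+ / 2 - (b + C)^-; integrating the positive part shows that C
   solves the equation of c(., mu_t), whose right-hand side is a contraction of
   ratio 1/2. That mu_t has a finite second moment follows from
   X_t = X_0 + int beta ds + M_t: the drift integral is controlled by the energy,
   and M_t is at finite L^2-distance of the integral of a simple process. *)

Require Import Defs.
From mathcomp Require Import all_boot all_order all_algebra.
From mathcomp Require Import all_classical all_reals all_analysis.
From mathcomp Require Import measurable_realfun.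
From mathcomp Require Import lra ring.

Set Implicit Arguments.
Unset Strict Implicit.
Unset Printing Implicit Defensive.
Import Order.TTheory GRing.Theory Num.Theory.
Import numFieldNormedType.Exports.
Local Open Scope classical_set_scope.
Local Open Scope ring_scope.

(* The integral of a nonnegative function is a supremum over the simple functions
   below it, so monotonicity needs no measurability. *)
Lemma lower_integral_le d (T : measurableType d) (R : realType)
    (m : {measure set T -> \bar R}) (D : set T) (f g : T -> \bar R) :
  (forall x, D x -> 0 <= f x)%E -> (forall x, D x -> f x <= g x)%E ->
  (\int[m]_(x in D) f x <= \int[m]_(x in D) g x)%E.
Proof.
move=> f0 fg; rewrite !ge0_integralE//; last first.
  by move=> x Dx; exact: le_trans (f0 x Dx) (fg x Dx).
apply: ereal_sup_le => _ [h hf <-]; exists h => // x.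
by apply: le_trans (hf x) _; exact: lee_restrict.
Qed.

(** * Square-integrable random variables *)

Definition sq_integrable d (Om : measurableType d) (R : realType)
    (P : probability Om R) (f : Om -> R) : Prop :=
  measurable_fun setT f /\ (\int[P]_w (f w ^+ 2)%:E < +oo)%E.

Section square_integrable.
Context d (Om : measurableType d) (R : realType) (P : probability Om R).
Implicit Types f g : Om -> R.

Lemma measurable_sqr_EFin f : measurable_fun setT f ->
  measurable_fun setT (fun w => (f w ^+ 2)%:E).
Proof.
by move=> mf; apply/measurable_EFinP; exact: (measurable_funX 2%N mf).
Qed.

Lemma sq_integrable_le f g K : 0 <= K -> measurable_fun setT f ->
  (forall w, f w ^+ 2 <= K * g w ^+ 2) -> sq_integrable P g ->
  sq_integrable P f.
Proof.
move=> K0 mf fg [mg gy]; split => //.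
apply: (@le_lt_trans _ _ (\int[P]_w (K%:E * (g w ^+ 2)%:E))%E).
  apply: lower_integral_le => w _; first by rewrite lee_fin sqr_ge0.
  by rewrite -EFinM lee_fin.
rewrite ge0_integralZl_EFin//; last exact: measurable_sqr_EFin.
  by rewrite lte_mul_pinfty.
by move=> w _; rewrite lee_fin sqr_ge0.
Qed.

(** This rests on (f + g)^2 <= 2 (f^2 + g^2), whose two sides differ by (f - g)^2. *)
Lemma sq_integrableD f g : sq_integrable P f -> sq_integrable P g ->
  sq_integrable P (fun w => f w + g w).
Proof.
move=> [mf fy] [mg gy]; split; first exact: measurable_funD.
apply: (@le_lt_trans _ _
  (\int[P]_w (2%:E * ((f w ^+ 2)%:E + (g w ^+ 2)%:E)))%E).
  apply: lower_integral_le => w _; first by rewrite lee_fin sqr_ge0.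
  rewrite -EFinD -EFinM lee_fin; have := sqr_ge0 (f w - g w); lra.
rewrite ge0_integralZl_EFin//; last 2 first.
- by move=> w _; rewrite -EFinD lee_fin addr_ge0 ?sqr_ge0.
- by apply: emeasurable_funD; exact: measurable_sqr_EFin.
rewrite lte_mul_pinfty// ge0_integralD//.
- by rewrite lte_add_pinfty.
- by move=> w _; rewrite lee_fin sqr_ge0.
- exact: measurable_sqr_EFin.
- by move=> w _; rewrite lee_fin sqr_ge0.
- exact: measurable_sqr_EFin.
Qed.

Lemma sq_integrableM f g K : measurable_fun setT f ->
  (forall w, `|f w| <= K) -> sq_integrable P g ->
  sq_integrable P (fun w => f w * g w).
Proof.
move=> mf fK gP; apply: (@sq_integrable_le _ g (K ^+ 2)) => //.
- exact: sqr_ge0.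
- by apply: measurable_funM => //; case: gP.
- move=> w; rewrite exprMn ler_wpM2r ?sqr_ge0// -[leLHS]real_normK ?num_real//.
  by rewrite lerXn2r// nnegrE ?normr_ge0// (le_trans _ (fK w)).
Qed.

Lemma sq_integrable0 : sq_integrable P (fun=> 0).
Proof.
split=> //; rewrite (_ : (fun=> _) = cst 0%E) ?integral0 ?ltry//.
by apply/funext => w; rewrite expr0n.
Qed.

Lemma sq_integrable_sum n (f : 'I_n -> Om -> R) :
  (forall i, sq_integrable P (f i)) ->
  sq_integrable P (fun w => \sum_(i < n) f i w).
Proof.
elim: n f => [|n IHn] f fP.
  by under eq_fun do rewrite big_ord0; exact: sq_integrable0.
under eq_fun do rewrite big_ord_recr /=.
by apply: sq_integrableD => //; exact: IHn.
Qed.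

Lemma sq_integrableN f : sq_integrable P f -> sq_integrable P (fun w => - f w).
Proof.
move=> [mf fy]; split; first exact: measurableT_comp.
by under eq_integral do rewrite sqrrN.
Qed.

Lemma sq_integrableB f g : sq_integrable P f -> sq_integrable P g ->
  sq_integrable P (fun w => f w - g w).
Proof. by move=> fP gP; apply: sq_integrableD => //; exact: sq_integrableN. Qed.

(* h need not be measurable: its integral is then a lower integral. *)
Lemma sq_integrable_ae f (h : Om -> \bar R) : measurable_fun setT f ->
  (forall w, 0 <= h w)%E -> {ae P, forall w, ((f w ^+ 2)%:E <= h w)%E} ->
  (\int[P]_w h w < +oo)%E -> sq_integrable P f.
Proof.
move=> mf h0 [N [mN PN0 fhN]] hy; split => //.
rewrite (@ge0_negligible_integral _ _ _ P _ N)//.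
- rewrite setTD; apply: le_lt_trans hy.
  rewrite integral_mkcond; apply: lower_integral_le => w _.
    by rewrite /patch; case: ifPn => // _; rewrite lee_fin sqr_ge0.
  rewrite /patch; case: ifPn => // /set_mem wN.
  by apply: contrapT => fhw; apply: wN; exact: fhN.
- exact: measurable_sqr_EFin.
- by move=> w _; rewrite lee_fin sqr_ge0.
Qed.

End square_integrable.

(** * Finite second moment of the centred normal law *)

Section normal_second_moment.
Variables (R : realType) (s : R).
Hypothesis s0 : s != 0.
Local Notation leb := (@lebesgue_measure R).

(** A Gaussian of doubled standard deviation absorbs the factor x^2. With y = x^2 / (4 s^2) the
    claim reduces to y exp(-2y) <= exp(-y/2), which holds because y exp(-y) <= 1 and exp(-y) <=
    exp(-y/2). *)
Lemma sqr_normal_pdf_le x :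
  x ^+ 2 * normal_pdf 0 s x <=
  4 * s ^+ 2 * normal_peak s / normal_peak (2 * s) * normal_pdf 0 (2 * s) x.
Proof.
have s20 : 2 * s != 0 by rewrite mulf_neq0.
have ss : 0 < s ^+ 2 by rewrite exprn_even_gt0.
have p20 : normal_peak (2 * s) != 0 by rewrite gt_eqF ?normal_peak_gt0.
rewrite !normal_pdfE//= [leLHS]mulrCA -[leRHS]mulrA mulKf// (mulrC (4 * _)) -[leRHS]mulrA.
rewrite ler_wpM2l ?normal_peak_ge0//.

rewrite /normal_fun !subr0.
set y := x ^+ 2 / (4 * s ^+ 2).
have -> : - x ^+ 2 / (s ^+ 2 *+ 2) = - y - y.
  by rewrite /y; field; rewrite s0.
have -> : - x ^+ 2 / ((2 * s) ^+ 2 *+ 2) = - (y / 2).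
  by rewrite /y; field; rewrite s0.
have -> : x ^+ 2 = 4 * s ^+ 2 * y by rewrite /y; field; rewrite s0.
have s4 : 0 <= 4 * s ^+ 2 by apply: mulr_ge0 => //; exact: ltW.
have y0 : 0 <= y by apply: divr_ge0 => //; exact: sqr_ge0.
rewrite -[leLHS]mulrA ler_wpM2l//.
rewrite expRD mulrA -[leRHS]mul1r ler_pM ?expR_ge0//.
- by rewrite mulr_ge0 ?expR_ge0.
- by rewrite expRN ler_pdivrMr ?expR_gt0// mul1r (le_trans _ (expR_ge1Dx _))// lerDr.
- by rewrite ler_expR; lra.
Qed.

Lemma normal_second_moment_lty :
  (\int[normal_prob 0 s]_x (x ^+ 2)%:E < +oo)%E.
Proof.
have mpdf (r : R) : measurable_fun setT (EFin \o normal_pdf 0 r).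
  by apply/measurable_EFinP; exact: measurable_normal_pdf.
have dom := normal_prob_dominates (0 : R) s.
have msq : measurable_fun setT (fun x : R => (x ^+ 2)%:E).
  by apply/measurable_EFinP; exact: measurable_funX.
rewrite -(Radon_Nikodym_SigmaFinite.change_of_variables dom)//; last first.
  by move=> x; rewrite lee_fin sqr_ge0.
(* The change of variables produces the Radon-Nikodym derivative of [normal_prob]. It equals
   [normal_pdf] almost everywhere, since both have the same integral over every measurable set. *)
rewrite (@ae_eq_integral _ _ _ leb setT
    (fun x => (x ^+ 2)%:E * (normal_pdf 0 s x)%:E)%E)//=.
- apply: (@le_lt_trans _ _ (\int[leb]_x
    ((4 * s ^+ 2 * normal_peak s / normal_peak (2 * s))%:E *
     (normal_pdf 0 (2 * s) x)%:E))%E).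
    apply: lower_integral_le => x _.
      by rewrite -EFinM lee_fin mulr_ge0 ?sqr_ge0 ?normal_pdf_ge0.
    by rewrite -!EFinM lee_fin sqr_normal_pdf_le.
  rewrite ge0_integralZl_EFin//; last 3 first.
  - by move=> x _; rewrite lee_fin normal_pdf_ge0.
  - exact: mpdf.
  - apply: divr_ge0; last exact: normal_peak_ge0.
    apply: mulr_ge0; last exact: normal_peak_ge0.
    by apply: mulr_ge0 => //; exact: sqr_ge0.
  by rewrite integral_normal_pdf mule1 ltry.
- apply: emeasurable_funM => //.
  exact: measurable_int (Radon_Nikodym_SigmaFinite.f_integrable dom).
- by apply: emeasurable_funM => //; exact: mpdf.
- apply: ae_eqe_mul2l; apply: integral_ae_eq => //.
  + exact: Radon_Nikodym_SigmaFinite.f_integrable.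
  + exact: mpdf.
  + by move=> E _ mE; rewrite -Radon_Nikodym_SigmaFinite.f_integral.
Qed.

End normal_second_moment.

(** * Square integrability of Itô integrals *)

Section ito_square_integrable.
Context (R : realType) d (Om : measurableType d) (P : probability Om R) (T : R).
Variables (F : R -> set (set Om)) (W : R -> Om -> R).
Hypotheses (filF : is_filtration T F) (BW : brownian P T F W).

Lemma adapted_measurable (X : R -> Om -> R) t : adapted T F X ->
  0 <= t <= T -> measurable_fun setT (X t).
Proof.
move=> XF tT _ A mA; rewrite setTI.
by have [_] := filF.1 t tT; apply; exact: XF.
Qed.

Lemma sq_integrable_brownian_increment s t : 0 <= s -> s <= t -> t <= T ->
  sq_integrable P (increment W s t).
Proof.
(* [brownian_gaussian] speaks of s < t only, whereas the truncated times of a simple process may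
   coincide, so the zero increment is treated apart. *)
move=> s0; rewrite le_eqVlt => /predU1P[<- _|st tT].
  rewrite (_ : increment W s s = fun=> 0); first exact: sq_integrable0.
  by apply/funext => w; rewrite /increment subrr.
have mW : measurable_fun setT (increment W s t).
  apply: measurable_funB; apply: adapted_measurable (brownian_adapted BW) _.
    by rewrite (le_trans s0 (ltW st)).
  by rewrite s0 (le_trans (ltW st)).
pose phi : Om -> measurableTypeR R := increment W s t.
have mphi : measurable_fun setT phi := mW.
split=> //.
have <- := @ge0_integral_pushforward _ _ _ _ _ _ mphi P setT
  (fun x => (x ^+ 2)%:E); last 3 first.
- by [].
- by apply/measurable_EFinP; exact: measurable_funX.
- by move=> x _; rewrite lee_fin sqr_ge0.
rewrite (@eq_measure_integral _ _ _ setT (normal_prob 0 (Num.sqrt (t - s)))).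
  by apply: normal_second_moment_lty; rewrite gt_eqF// sqrtr_gt0 subr_gt0.
by move=> A mA _; exact: brownian_gaussian BW _ _ s0 st tT A mA.
Qed.

Lemma sq_integrable_sp_integral (S : simple_process T F) t : 0 <= t <= T ->
  sq_integrable P (sp_integral S W t).
Proof.
move=> /andP[t0 tT]; have [K SK] := sp_coef_bounded S.
apply: sq_integrable_sum => i.
have /andP[ti0 tiT] := @sp_time_itv _ _ _ _ _ S _ (ltnW (ltn_ord i)).
have /andP[tj0 tjT] := @sp_time_itv _ _ _ _ _ S _ (ltn_ord i).
apply: (@sq_integrableM _ _ _ _ _ _ K).
- move=> _ A mA; rewrite setTI.
  have [|_] := filF.1 (sp_time S i); first by rewrite ti0.
  by apply; exact: sp_coef_meas.
- by move=> w; exact: SK.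
- apply: sq_integrable_brownian_increment.
  + by rewrite le_min ti0.
  + by rewrite le_min !ge_min lexx sp_time_le// orbT.
  + by rewrite ge_min tjT.
Qed.

(** A single approximation suffices: once the simple integral S_n is at finite L^2-distance of
    [M t], write [M t] as S_n - (S_n - M_t), a difference of two square-integrable variables. *)
Lemma sq_integrable_ito_integral (H M : R -> Om -> R) t :
  ito_integral P T F W H M -> 0 <= t <= T -> sq_integrable P (M t).
Proof.
move=> [mM [_ [S [_ SM]]]] tT.
have mS n := sq_integrable_sp_integral (S n) tT.
have [n Sn] : exists n,
    (\int[P]_w ((sp_integral (S n) W t w - M t w) ^+ 2)%:E < 1)%E.
  have [N _ SN] := SM t tT _ (@nbhs_open_ereal_lt R 0 (cst 1) ltr01).
  by exists N; exact: SN N (leqnn N).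
have MS : sq_integrable P (fun w => sp_integral (S n) W t w - M t w).
  split; last exact: lt_trans Sn (ltry _).
  by apply: measurable_funB; [case: (mS n)|exact: mM].
rewrite (_ : M t = fun w =>
  sp_integral (S n) W t w - (sp_integral (S n) W t w - M t w)).
  exact: sq_integrableB.
by apply/funext => w; rewrite subKr.
Qed.

End ito_square_integrable.

(** * Cauchy-Schwarz for the drift and square integrability of Itô processes *)

Lemma integrable_cst d (T : measurableType d) (R : realType)
    (m : {measure set T -> \bar R}) (D : set T) (r : R) :
  measurable D -> (m D < +oo)%E -> m.-integrable D (fun=> r%:E).
Proof.
move=> mD Dy; apply/integrableP; split => //.
rewrite (integral_cst m mD `|r%:E|%E) lte_mul_pinfty//.
Qed.

(* Integrate [f ^+ 2 >= 2 * a * f - a ^+ 2] with [a] the integral of [f] over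
   [V]. *)
Lemma sqr_Rintegral_le d (T : measurableType d) (R : realType)
    (m : {measure set T -> \bar R}) (D : set T) (V : R) (f : T -> R) :
  measurable D -> 0 < V -> (m D <= V%:E)%E -> measurable_fun D f ->
  (((\int[m]_(x in D) f x) ^+ 2 / V)%:E <= \int[m]_(x in D) (f x ^+ 2)%:E)%E.
Proof.
move=> mD V0 DV mf.
have Dy : (m D < +oo)%E := le_lt_trans DV (ltry V).
have [v Dv] : exists v, m D = v%:E.
  by exists (fine (m D)); rewrite fineK// ge0_fin_numE.
have vV : v <= V by rewrite -lee_fin -Dv.
have mf2 : measurable_fun D (fun x => (f x ^+ 2)%:E).
  by apply/measurable_EFinP; exact: (measurable_funX 2%N mf).
have [->|f2y] := eqVneq (\int[m]_(x in D) (f x ^+ 2)%:E)%E +oo%E.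
  by rewrite leey.
have i2 : m.-integrable D (fun x => (f x ^+ 2)%:E).
  apply/integrableP; split => //.
  rewrite ltey (_ : (\int[m]_(x in D) _)%E =
    (\int[m]_(x in D) (f x ^+ 2)%:E)%E)//.
  by apply: eq_integral => x _; rewrite gee0_abs// lee_fin sqr_ge0.
(* Here |f| <= f^2 + 1, and [D] has finite measure. *)
have i1 : m.-integrable D (fun x => (f x)%:E).
  apply: (@le_integrable _ _ _ _ _ mD _ (fun x => (f x ^+ 2)%:E + 1%:E)%E).
  - exact/measurable_EFinP.
  - move=> x _; rewrite -EFinD !abse_EFin lee_fin [leRHS]ger0_norm; last first.
      by rewrite addr_ge0 ?sqr_ge0.
    rewrite ler_norml; have := sqr_ge0 (f x - 1); have := sqr_ge0 (f x + 1).
    by move=> ? ?; apply/andP; split; nra.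
  - by apply: integrableD => //; exact: integrable_cst.
set I := (\int[m]_(x in D) f x); pose a := I / V.
have IE : (\int[m]_(x in D) (f x)%:E = I%:E)%E.
  by rewrite /I /Rintegral fineK//; exact: integrable_fin_num.
have iB : m.-integrable D (fun x => (2 * a)%:E * (f x)%:E - (a ^+ 2)%:E)%E.
  apply: integrableB => //; first exact: integrableZl.
  exact: integrable_cst.
apply: (@le_trans _ _ (\int[m]_(x in D) ((2 * a)%:E * (f x)%:E - (a ^+ 2)%:E))%E);
  last first.
  apply: le_integral => // x _; rewrite -EFinM -EFinB lee_fin.
  have := sqr_ge0 (f x - a); nra.
rewrite integralB//; last 2 first.
- exact: integrableZl.
- exact: integrable_cst.
rewrite integralZl// IE (integral_cst m mD (a ^+ 2)%:E) Dv -!EFinM -EFinB lee_fin.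
(* The choice a = I / V maximizes 2 a I - a^2 V. Replacing V by the actual measure v <= V can only
   increase this value. *)
have -> : I ^+ 2 / V = 2 * a * I - a ^+ 2 * V by rewrite /a; field; rewrite gt_eqF.
by rewrite lerD2l lerN2 ler_wpM2l ?sqr_ge0.
Qed.

(** Both hypotheses concern [0,T] only. Extending the path by 0 makes s |-> (s, (u, x s)) measurable
    on the whole line without changing it on [0,T]. *)
Lemma measurable_coef_along_path (R : realType) (T : R) (beta : R -> label R -> R -> R)
    (x : R -> R) (u : label R) :
  measurable_fun (`[0, T]%classic `*` setT)
    (fun z : R * (label R * R) => beta z.1 z.2.1 z.2.2) ->
  {within `[0, T], continuous x} ->
  measurable_fun `[0, T]%classic (fun s => beta s u (x s)).
Proof.
move=> mbeta cx; set D := `[0, T]%classic in mbeta cx *.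
have mD : measurable D by exact: measurable_itv.
have mx : measurable_fun setT (x \_ D).
  have mDx : measurable_fun D x.
    exact: (subspace_continuous_measurable_fun mD cx).
  exact: (measurable_restrictT x mD).1 mDx.
apply: (@eq_measurable_fun _ _ _ _ D
  ((fun z : R * (label R * R) => beta z.1 z.2.1 z.2.2) \o
   (fun s => (s, (u, (x \_ D) s))))).
  by move=> s sD /=; rewrite patchT.
apply: (measurable_comp _ _ mbeta).
- exact: measurableX.
- by move=> _ [s sD <-].
- apply: measurable_funTS; apply/measurable_fun_pair => //.
  by apply/measurable_fun_pair => //; exact: measurable_cst.
Qed.

Lemma sq_integrable_ito_process (R : realType) d (Om : measurableType d)
    (P : probability Om R) (T : R) (F : R -> set (set Om)) (W : R -> Om -> R)
    (U : Om -> label R) (X : R -> Om -> R) (beta gamma : R -> label R -> R -> R) t :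
  0 < T -> ito_dynamics P T F W U X beta gamma -> sq_integrable P (X 0) ->
  0 <= t <= T -> sq_integrable P (X t).
Proof.
move=> T0 [filF BW _ aX cX mbeta _ energy [M [MP XE]]] X0P tT.
have MtP := sq_integrable_ito_integral filF BW MP tT.
have mX s : 0 <= s <= T -> measurable_fun setT (X s).
  by move=> sT; apply: adapted_measurable filF _ _ aX sT.
(* Almost surely [D] is the drift integral over [0,t] divided by the square root of T. Defining it
   through X and M makes its measurability immediate, and the scaling makes its square bounded by
   the integral of beta^2 over [0,T]. *)
pose D w := (Num.sqrt T)^-1 * (X t w - X 0 w - M t w).
have mD : measurable_fun setT D.
  apply: measurable_funM => //; apply: measurable_funB; last by case: MtP.
  by apply: measurable_funB; [exact: mX | case: X0P].
have DP : sq_integrable P D.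
  refine (sq_integrable_ae mD _ _ energy).
    by move=> w; apply: integral_ge0 => s _; rewrite lee_fin addr_ge0// sqr_ge0.
  apply: (filterS _ XE) => w XwE.
  rewrite /D (XwE t tT) exprMn exprVn sqr_sqrtr; last exact: ltW.
  rewrite mulrC.
  rewrite (_ : _ - M t w = \int[lebesgue_measure]_(s in `[0, t]) beta s (U w) (X s w));
    last ring.
  have /andP[t0 t1] := tT.
  have sub : `[0, t] `<=` `[0, T].
    by move=> s /=; rewrite !in_itv/= => /andP[-> /le_trans ->].
  have mb := measurable_coef_along_path (U w) mbeta (cX w).
  have mbt := measurable_funS (measurable_itv _) sub mb.
  have tV : (@lebesgue_measure R `[0%R, t]%classic <= T%:E)%E.
    by rewrite lebesgue_measure_itv/=; case: ifP; rewrite lee_fin ?subr0// ltW.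
  (* The length of [0,t] is bounded by T rather than by t, because this bound must be positive and t
     may be 0. *)
  have CS := @sqr_Rintegral_le _ _ R (@lebesgue_measure R) `[0%R, t]%classic T
    (fun s => beta s (U w) (X s w)) (measurable_itv _) T0 tV mbt.
  apply: (le_trans CS).
  apply: (@le_trans _ _ (\int[lebesgue_measure]_(s in `[0%R, T])
      (beta s (U w) (X s w) ^+ 2)%:E)%E).
    apply: ge0_subset_integral => //.
    - by apply/measurable_EFinP; exact: (measurable_funX 2%N mb).
    - by move=> s _; rewrite lee_fin sqr_ge0.
  apply: lower_integral_le => s _; first by rewrite lee_fin sqr_ge0.
  by rewrite lee_fin -[leLHS]real_normK ?num_real// lerDl sqr_ge0.
(* By the definition of [D], this decomposition of [X t] holds at every w, not only almost
   surely. *)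
apply: (@sq_integrable_le _ _ _ _ _ (fun w => Num.sqrt T * D w + X 0 w + M t w) 1) => //.
- exact: mX.
- move=> w; rewrite mul1r /D mulVKf ?gt_eqF ?sqrtr_gt0//.
  by rewrite [leRHS](_ : _ = X t w ^+ 2)//; ring.
- apply: sq_integrableD => //; apply: sq_integrableD => //.
  apply: (@sq_integrable_le _ _ _ _ _ D T) => //; first exact: ltW.
    by apply: measurable_funM.
  by move=> w; rewrite exprMn sqr_sqrtr// ltW.
Qed.

(** * Second moments of the time marginals *)

Section marginal_moments.
Context (R : realType).
Local Notation I := (label R).

Lemma measurable_label_val : measurable_fun setT (@label_val R).
Proof. by move=> _ A mA; rewrite setTI; exists A => //; rewrite setTI. Qed.

Lemma label_val_itv (u : I) : 0 <= label_val u <= 1.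
Proof. by have := valP u; rewrite inE /= in_itv. Qed.

Lemma measurable_sqr_norm :
  measurable_fun setT (fun z : I * R => label_val z.1 ^+ 2 + z.2 ^+ 2).
Proof.
apply: measurable_funD; apply: (measurable_funX 2%N).
  exact: measurableT_comp measurable_label_val measurable_fst.
exact: measurable_snd.
Qed.

Lemma sqr_norm_powR2 (z : I * R) :
  Num.sqrt (label_val z.1 ^+ 2 + z.2 ^+ 2) `^ 2 = label_val z.1 ^+ 2 + z.2 ^+ 2.
Proof. by rewrite powR_mulrn ?sqrtr_ge0// sqr_sqrtr// addr_ge0 ?sqr_ge0. Qed.

(** This uses r^2 <= 1 + r^p: the term 1 covers r < 1, and for r >= 1 the power r^p increases with
    p. *)
Lemma finite_moment_snd (p : R) (m : probability (I * R)%type R) : 2 <= p ->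
  finite_moment p m -> sq_integrable m snd.
Proof.
move=> p2 mp; split; first exact: measurable_snd.
pose r (z : I * R) := Num.sqrt (label_val z.1 ^+ 2 + z.2 ^+ 2).
have mr : measurable_fun setT r.
  exact: (measurableT_comp (continuous_measurable_fun (@sqrt_continuous R))
    measurable_sqr_norm).
have mg : measurable_fun setT (fun z => (r z `^ p)%:E).
  by apply/measurable_EFinP; exact: (measurableT_comp (measurable_powR p) mr).
apply: (@le_lt_trans _ _ (\int[m]_z (1%:E + (r z `^ p)%:E))%E).
  apply: lower_integral_le => z _; first by rewrite lee_fin sqr_ge0.
  rewrite -EFinD lee_fin.
  have zr : z.2 ^+ 2 <= r z `^ 2 by rewrite sqr_norm_powR2 lerDr sqr_ge0.
  apply: (le_trans zr); have [/ltW r1|r1] := ltP (r z) 1.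
    rewrite -[leLHS]addr0 lerD ?powR_ge0// powR_mulrn ?sqrtr_ge0//.
    by rewrite expr_le1 ?sqrtr_ge0.
  by rewrite (le_trans (ler_powR r1 p2))// lerDr.
rewrite ge0_integralD//; last first.
  by move=> z _; rewrite lee_fin powR_ge0.
rewrite integral_cst// mul1e lte_add_pinfty//.
exact: le_lt_trans (probability_le1 m measurableT) (ltry 1).
Qed.

(** The label lies in [0,1], so it adds at most 1 to the squared norm. *)
Lemma P2_time_marginal (T : R) (mu : probability (canonical_space T) R) t :
  sq_integrable mu (canonical_X t) -> P2 (time_marginal mu t).
Proof.
move=> [mX X2]; rewrite /P2 /finite_moment.
under eq_integral do rewrite sqr_norm_powR2.
rewrite ge0_integral_distribution; last 2 first.
- by apply/measurable_EFinP; exact: measurable_sqr_norm.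
- by move=> z; rewrite lee_fin addr_ge0 ?sqr_ge0.
apply: (@le_lt_trans _ _ (\int[mu]_w (1%:E + (canonical_X t w ^+ 2)%:E))%E).
  apply: lower_integral_le => w _; first by rewrite lee_fin addr_ge0 ?sqr_ge0.
  rewrite -EFinD lee_fin lerD2r.
  have /andP[u0 u1] := label_val_itv (canonical_U w).
  by rewrite expr_le1.
rewrite ge0_integralD//; last first.
- exact: measurable_sqr_EFin.
- by move=> w _; rewrite lee_fin sqr_ge0.
rewrite integral_cst// mul1e lte_add_pinfty//.
exact: le_lt_trans (probability_le1 mu measurableT) (ltry 1).
Qed.

Lemma sq_integrable_initial (T : R) (mu : probability (canonical_space T) R)
    (nu : probability (I * R)%type R) (p : R) : 2 <= p -> finite_moment p nu ->
  (forall A, measurable A -> time_marginal mu 0 A = nu A) ->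
  sq_integrable mu (canonical_X 0).
Proof.
move=> p2 /(finite_moment_snd p2)[_ nu2] munu; split.
  exact: measurableT_comp (measurable_path_val 0) measurable_snd.
have m2 : measurable_fun setT (fun z : I * R => (z.2 ^+ 2)%:E).
  by apply: measurable_sqr_EFin; exact: measurable_snd.
rewrite -(@ge0_integral_distribution _ _ _ _ _ mu (canonical_UX 0) _ m2); last first.
  by move=> z; rewrite lee_fin sqr_ge0.
by rewrite (@eq_measure_integral _ _ _ setT nu)// => A mA _; exact: munu.
Qed.

End marginal_moments.

(** * The scalar fixed-point equation for c *)

(** Right-hand side of the equation of c at a fixed pair (t, m), as a function of the unknown
    number; [f] stands for (v,y) |-> b(t,y,[Gm](v)). *)
Definition half_mean_pos_part d (T : measurableType d) (R : realType)
    (m : probability T R) (f : T -> R) (c : R) : R :=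
  2^-1 * \int[m]_z pos_part (c + f z).

Section half_positive_part.
Context d (T : measurableType d) (R : realType) (m : probability T R) (f : T -> R).
Hypothesis mf : m.-integrable setT (EFin \o f).
Local Notation phi := (half_mean_pos_part m f).


Lemma pos_part_ge0 (a : R) : 0 <= pos_part a.
Proof. by rewrite /pos_part le_max lexx orbT. Qed.

Lemma ler_dist_pos_part (a b : R) : `|pos_part a - pos_part b| <= `|a - b|.
Proof.
by rewrite /pos_part /Num.max !ltNge; case: (leP 0 a) => ?; case: (leP 0 b) => ? /=;
  rewrite ler_norml; apply/andP; split; rewrite ?subr0 ?sub0r;
  have := ler_norm (a - b); have := ler_norm (b - a); rewrite (distrC b); lra.
Qed.

Lemma integrable_pos_part c : m.-integrable setT (fun z => (pos_part (c + f z))%:E).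
Proof.
have mmf : measurable_fun setT f by apply/measurable_EFinP; case/integrableP: mf.
apply: (@le_integrable _ _ _ _ _ measurableT _ (fun z => c%:E + (f z)%:E)%E).
- apply/measurable_EFinP; apply: measurable_maxr => //.
  exact: measurable_funD.
- move=> z _; rewrite -EFinD !abse_EFin lee_fin.
  (* Comparison with the positive part of 0 gives the domination by |c + f|. *)
  by have := ler_dist_pos_part (c + f z) 0; rewrite /(pos_part 0) maxxx !subr0.
- apply: integrableD => //; exact: finite_measure_integrable_cst.
Qed.

(** The positive part is 1-Lipschitz and [m] has total mass one, so only the factor 1/2 remains. *)
Lemma half_mean_pos_part_lipschitz c c' : `|phi c - phi c'| <= 2^-1 * `|c - c'|.
Proof.
rewrite /half_mean_pos_part -mulrBr normrM ger0_norm// ler_wpM2l//.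
rewrite -RintegralB//; try exact: integrable_pos_part.
have iB : m.-integrable setT (EFin \o
    (fun z => pos_part (c + f z) - pos_part (c' + f z))).
  exact: (integrableB measurableT (integrable_pos_part c) (integrable_pos_part c')).
apply: le_trans (le_normr_Rintegral _ _) _ => //.
have -> : `|c - c'| = \int[m]_z `|c - c'|.
  by rewrite Rintegral_cst// [X in fine X](@probability_setT _ _ _ m) mulr1.
apply: le_Rintegral => //.
- exact: integrable_norm.
- exact: finite_measure_integrable_cst.
move=> z _; apply: le_trans (ler_dist_pos_part _ _) _.
by rewrite opprD addrACA subrr addr0.
Qed.

Lemma half_pos_part_fixpoint_uniq c c' : c = phi c -> c' = phi c' -> c = c'.
Proof.
move=> cE c'E; have := half_mean_pos_part_lipschitz c c'; rewrite -cE -c'E => h.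
by apply/eqP; rewrite -subr_eq0 -normr_le0; lra.
Qed.

(** Banach's theorem on the complete space of the reals, with ratio 1/2. *)
Lemma half_pos_part_fixpoint : exists c, c = phi c.
Proof.
have [|//||c _ cE] := @banach_fixed_point R R^o setT (totalfun_ setT phi).
- exists (2^-1)%:nng; split => /=; first by lra.
  by move=> [x y] _ /=; exact: half_mean_pos_part_lipschitz.
- by exists 0.
- by exists c.
Qed.

(** Links the extended-real equation of [c_solution] to the real one; the integral is finite because
    the integrand is integrable. *)
Lemma half_pos_partE c : (c%:E = (2^-1)%:E * \int[m]_z (pos_part (c + f z))%:E)%E
  <-> c = phi c.
Proof.
rewrite /half_mean_pos_part /Rintegral.
rewrite -[X in (_ * X)%E](fineK (integrable_fin_num measurableT (integrable_pos_part c))).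
by rewrite -EFinM; split => [[]|] cE; [exact: cE | rewrite -cE].
Qed.

Lemma half_pos_part_fixpoint_ge0 c : c = phi c -> 0 <= c.
Proof.
move=> ->; rewrite /half_mean_pos_part mulr_ge0// Rintegral_ge0// => z _; exact: pos_part_ge0.
Qed.

End half_positive_part.

(** * Change of coefficients, identification of the drift, and conclusion *)

(** Every condition of [ito_dynamics] evaluates the coefficients at times in [0,T] only. *)
Lemma ito_dynamics_eq (R : realType) d (Om : measurableType d)
    (P : probability Om R) (T : R) (F : R -> set (set Om)) (W : R -> Om -> R)
    (U : Om -> label R) (X : R -> Om -> R)
    (beta gamma beta' gamma' : R -> label R -> R -> R) :
  (forall s u x, 0 <= s <= T -> beta s u x = beta' s u x) ->
  (forall s u x, 0 <= s <= T -> gamma s u x = gamma' s u x) ->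
  ito_dynamics P T F W U X beta gamma -> ito_dynamics P T F W U X beta' gamma'.
Proof.
move=> bb gg [filF BW mU aX cX mbeta mgamma energy [M [[mM [cM [S [SH SM]]]] XE]]].
split => //.
- apply: eq_measurable_fun mbeta => -[s [u x]] /set_mem[/= + _].
  by rewrite in_itv/= => sT; exact: bb.
- apply: eq_measurable_fun mgamma => -[s [u x]] /set_mem[/= + _].
  by rewrite in_itv/= => sT; exact: gg.
- rewrite (_ : (\int[P]_w _)%E = \int[P]_w \int[lebesgue_measure]_(s in `[0%R, T])
    (`|beta s (U w) (X s w)| ^+ 2 + `|gamma s (U w) (X s w)| ^+ 2)%:E)%E//.
  apply: eq_integral => w _; apply: eq_integral => s /set_mem/=.
  by rewrite in_itv/= => sT; rewrite bb ?gg.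
- exists M; split.
    split=> //; split=> //; exists S; split=> //.
    rewrite (_ : (fun n => _) = fun n => (\int[P]_w \int[lebesgue_measure]_(s in `[0%R, T])
      ((sp_val (S n) s w - gamma s (U w) (X s w)) ^+ 2)%:E)%E)//.
    apply/funext => n; apply: eq_integral => w _; apply: eq_integral => s /set_mem/=.
    by rewrite in_itv/= => sT; rewrite gg.
  apply: filterS XE => w XwE t tT; rewrite (XwE t tT); congr (_ + _ + _).
  apply: eq_Rintegral => s /set_mem/=; rewrite in_itv/= => /andP[s0 st].
  by rewrite bb// s0 (le_trans st)//; case/andP: tT.
Qed.

(** The denominator is positive, so B and a have the same sign: a = 2B if B >= 0, and a = B
    otherwise. *)
Lemma half_positive_drift (R : realType) (B a : R) : B = a / (1 + (0 <= B)%R%:R) ->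
  (0 <= B)%R%:R * B = 2^-1 * pos_part a /\ B = 2^-1 * pos_part a - neg_part a.
Proof.
rewrite /pos_part /neg_part; have [B0|B0] := leP 0 B => /= BE.
  have aE : a = 2 * B by rewrite BE; field.
  have a0 : 0 <= a by rewrite aE mulr_ge0.
  by rewrite max_l// max_r ?oppr_le0// subr0 mul1r aE; split; field.
have aE : a = B by rewrite BE addr0 divr1.
by rewrite aE max_r ?ltW// max_l ?oppr_ge0 ?ltW// mulr0 mul0r sub0r opprK.
Qed.

Theorem proposition2p1 (R : realType) (T : R) (G : graphon R)
  (b sigma : R -> R -> {finite_measure set R -> \bar R} -> R)
  (p : R) (nu : probability (label R * R)%type R)
  (mu : probability (canonical_space T) R)
  (Bmu Smu : R -> label R -> R -> R) :
  0 < T ->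
  (forall t (m : probability (label R * R)%type R), 0 <= t <= T -> P2 m ->
    m.-integrable setT (fun z => (b t z.2 (graphon_op G m z.1))%:E)) ->
  2 < p -> uniform_label nu fst -> finite_moment p nu ->
  PS nu mu Bmu Smu ->
  let mu_ := time_marginal mu in
  let pistar := pi_star Bmu in
  (forall t u x, 0 <= t <= T ->
    (mu_ t).-integrable setT
      (fun z => (pistar t u x z.1 z.2 * Bmu t z.1 z.2)%:E) /\
    (mu_ t).-integrable setT (fun z => (pistar t z.1 z.2 u x)%:E)) ->
  (forall t u x, 0 <= t <= T ->
    Bmu t u x = limit_drift G b pistar Bmu mu_ t u x /\
    Smu t u x = limit_diffusion G sigma pistar mu_ t u x) ->
  exists c : R -> probability (label R * R)%type R -> R,
    [/\ c_solution G b T c,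
        forall c', c_solution G b T c' ->
          forall t m, 0 <= t <= T -> P2 m -> c' t m = c t m,
        forall t, 0 <= t <= T -> P2 (mu_ t),
        forall t u x, 0 <= t <= T ->
          Bmu t u x = B_fun G b c t u x (mu_ t) /\
          Smu t u x = Sigma_fun G b sigma c t u x (mu_ t) &
        forall (d : measure_display) (Om : measurableType d)
          (P : probability Om R) (F : R -> set (set Om)) (W : R -> Om -> R)
          (U : Om -> label R) (X : R -> Om -> R),
          (forall t A, 0 <= t <= T -> measurable A ->
            P ((fun w => (U w, X t w)) @^-1` A) = mu_ t A) ->
          ito_dynamics P T F W U X
            (limit_drift G b pistar Bmu mu_) (limit_diffusion G sigma pistar mu_) <->
          ito_dynamics P T F W U X
            (fun t u x => B_fun G b c t u x (mu_ t))
            (fun t u x => Sigma_fun G b sigma c t u x (mu_ t))].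
Proof.
move=> T0 b_int p2 _ nu_p [_ [mu0 [F0 [W0 mu_ito]]]] mu_ pistar pi_int BS.
have P2mu t : 0 <= t <= T -> P2 (mu_ t).
  move=> tT; apply: P2_time_marginal.
  apply: (sq_integrable_ito_process T0 mu_ito) tT.
  exact: sq_integrable_initial (ltW p2) nu_p mu0.
pose bm t (m : probability (label R * R)%type R) (z : label R * R) :=
  b t z.2 (graphon_op G m z.1).
have bm_int t m : 0 <= t <= T -> P2 m -> m.-integrable setT (EFin \o bm t m).
  exact: b_int.
(* The default 0 is taken only where no fixed point exists; integrability of b excludes this for t
   in [0,T] and m in P2. *)
pose c t m := xget 0 [set r : R | r = half_mean_pos_part m (bm t m) r].
have cE t m : 0 <= t <= T -> P2 m -> c t m = half_mean_pos_part m (bm t m) (c t m).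
  move=> tT m2; have [r rE] := half_pos_part_fixpoint (bm_int t m tT m2).
  by apply: (@xgetPex _ 0 [set r : R | r = half_mean_pos_part m (bm t m) r]); exists r.
have c_uniq r t m : 0 <= t <= T -> P2 m ->
    r = half_mean_pos_part m (bm t m) r -> r = c t m.
  move=> tT m2 rE.
  by apply: (half_pos_part_fixpoint_uniq (bm_int t m tT m2) rE); exact: cE.
(* The weight ignores its first pair of arguments, so the integral in the numerator of the drift is
   this number, the same for all (u,x). *)
pose piB t := \int[mu_ t]_z ((0 <= Bmu t z.1 z.2)%R%:R * Bmu t z.1 z.2).
(* In the denominator the integrand is constant in the integration variable, so it integrates to the
   indicator at (u,x) against a mass of one. *)
have drift t u x : 0 <= t <= T -> Bmu t u x =
    (b t x (graphon_op G (mu_ t) u) + piB t) / (1 + (0 <= Bmu t u x)%R%:R).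
  move=> tT; rewrite [LHS](BS t u x tT).1 /limit_drift; congr (_ / (1 + _)).
  rewrite Rintegral_cst// [X in fine X](@probability_setT _ _ _ (mu_ t)).
  by rewrite mulr1.
(* Integrating the first identity of [half_positive_drift] shows that [piB t] solves the fixed-point
   equation at [mu_ t]; uniqueness identifies it with c. *)
have piBE t : 0 <= t <= T -> piB t = c t (mu_ t).
  move=> tT; have t2 := P2mu t tT; apply: c_uniq => //.
  rewrite /half_mean_pos_part -RintegralZl//; last first.
    exact: integrable_pos_part (bm_int t _ tT t2) (piB t).
  apply: eq_Rintegral => z _; rewrite (addrC (piB t)).
  exact: (half_positive_drift (drift t z.1 z.2 tT)).1.
have BmuE t u x : 0 <= t <= T -> Bmu t u x = B_fun G b c t u x (mu_ t).
  by move=> tT; rewrite /B_fun -piBE//; exact: (half_positive_drift (drift t u x tT)).2.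
have SmuE t u x : 0 <= t <= T -> Smu t u x = Sigma_fun G b sigma c t u x (mu_ t).
  move=> tT; rewrite (BS t u x tT).2 /limit_diffusion /Sigma_fun -BmuE//.
  rewrite Rintegral_cst// [X in fine X](@probability_setT _ _ _ (mu_ t)) mulr1.
  (* For an indicator i in {0,1}, 1 / (1 + i) = 1 - i / 2. *)
  by rewrite /pistar /pi_star; case: (0 <= Bmu t u x) => /=; field.
exists c; split=> //.
- move=> t m tT m2; have ct := cE t m tT m2; split.
    exact: half_pos_part_fixpoint_ge0 ct.
  by apply/(half_pos_partE (bm_int t m tT m2)).
- move=> c' c'E t m tT m2; apply: c_uniq => //.
  by apply/(half_pos_partE (bm_int t m tT m2)); have [] := c'E t m tT m2.
- by move=> t u x tT; split; [exact: BmuE | exact: SmuE].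
- move=> d Om P F W U X _.
  (* On [0,T] the identification relations make both forms of the coefficients equal to [Bmu] and
     [Smu], so the two dynamics differ only at times outside [0,T]. *)
  have eB t u x : 0 <= t <= T ->
      limit_drift G b pistar Bmu mu_ t u x = B_fun G b c t u x (mu_ t).
    by move=> tT; rewrite -(BS t u x tT).1; exact: BmuE.
  have eS t u x : 0 <= t <= T ->
      limit_diffusion G sigma pistar mu_ t u x = Sigma_fun G b sigma c t u x (mu_ t).
    by move=> tT; rewrite -(BS t u x tT).2; exact: SmuE.
  split; apply: ito_dynamics_eq => // s u x sT.
  + by rewrite eB.
  + by rewrite eS.
Qed.
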